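(* Let $G$ be a finite group, $\omega\in Z^3(G/Z(G),U(1))$ and $\eta\in Z^3(G,U(1))$. Let $\psi=(p,u,r,v)\in\operatorname{Aut}(\mathcal D(G))$. Then $\psi$ is a rigid isomorphism $\mathcal D^\omega(G)\to\mathcal D^\eta(G)$ if and only if $\omega^{u^*}=\eta$.
   Context: All algebras are over $\mathbb C$. $\mathbb CG$ is the group Hopf algebra and $\mathbb C^G$ its dual with dual basis $(e_g)$, unit $\varepsilon=\sum_ge_g$, counit $\mathrm{ev}_1(e_g)=\delta_{g,1}$. $Z^3(G,U(1))$ is the set of normalized 3-cocycles: functions $\omega\colon G^3\to U(1)$ with $\omega(g,1,h)=1$ and $\omega(a,b,c)\omega(a,bc,d)\omega(b,c,d)=\omega(ab,c,d)\omega(a,b,cd)$. Elements of $Z^3(G/Z(G),U(1))$ are regarded as elements of $Z^3(G,U(1))$ by pullback along $G\to G/Z(G)$. Put $$\theta_g(x,y)=\frac{\omega(g,x,y)\,\omega(x,y,(xy)^{-1}gxy)}{\omega(x,x^{-1}gx,y)},\qquad \gamma_x(g,h)=\frac{\omega(g,h,x)\,\omega(x,x^{-1}gx,x^{-1}hx)}{\omega(g,x,x^{-1}hx)}.$$ The twisted double $\mathcal D^\omega(G)$ has underlying space $\mathbb C^G\otimes\mathbb CG$, basis $e_g\#x$, multiplication $(e_g\#x)(e_h\#y)=\delta_{g,xhx^{-1}}\theta_g(x,y)e_g\#xy$, unit $\varepsilon\#1$, comultiplication $\Delta(e_g\#x)=\sum_t\gamma_x(gt^{-1},t)e_{gt^{-1}}\#x\otimes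 e_t\#x$, counit $\mathrm{ev}_1\otimes\varepsilon$, coassociator $\sum_{a,b,c}\omega(a,b,c)^{-1}e_a\#1\otimes e_b\#1\otimes e_c\#1$. $\mathcal D(G)=\mathcal D^1(G)$ is the untwisted double (a Hopf algebra on the same space) and $\operatorname{Aut}(\mathcal D(G))$ its group of Hopf algebra automorphisms. For $\psi\in\operatorname{Aut}(\mathcal D(G))$ write $\psi=(p,u,r,v)$ for its components: $u(e_g)=(\mathrm{id}\otimes\varepsilon)\psi(e_g\#1)$, $p(e_g)=(\mathrm{ev}_1\otimes\mathrm{id})\psi(e_g\#1)$, $r(x)=(\mathrm{id}\otimes\varepsilon)\psi(\varepsilon\#x)$, $v(x)=(\mathrm{ev}_1\otimes\mathrm{id})\psi(\varepsilon\#x)$, so that $\psi(e_g\#x)=\big(\sum_{k\in G}u(e_{gk^{-1}})\#p(e_k)\big)\cdot(r(x)\#v(x))$. Here $u$ is a Hopf algebra morphism $\mathbb C^G\to\mathbb C^G$, so its linear dual $u^*\colon\mathbb CG\to\mathbb CG$ is (the linear extension of) a group endomorphism of $G$; and $\omega^{u^*}(x,y,z)=\omega(u^*(x),u^*(y),u^*(z))$. A rigid isomorphism $\mathcal D^\omega(G)\to\mathcal D^\eta(G)$ is a bijective linear map $\mathbb C^G\otimes\mathbb CG\to\mathbb C^G\otimes\mathbb CG$ that is both a morphism of quasi-bialgebras $\mathcal D^\omega(G)\to\mathcal D^\eta(G)$ (unital algebra morphism respecting comultiplications, counits and coassociators) and a Hopf algebra morphism $\mathcal D(G)\to\mathcal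 D(G)$. *)

(* Defs.v *)
From HB Require Import structures.
From mathcomp Require Import all_boot all_order all_algebra all_fingroup all_solvable.

Set Implicit Arguments.
Unset Strict Implicit.
Unset Printing Implicit Defensive.

Import Order.TTheory GRing.Theory Num.Theory.
Local Open Scope ring_scope.

(* Free C B is the C-vector space with basis B; Free C (A * B) stands for the
   tensor product of Free C A and Free C B.  The regular module C^o matters:
   when C is R[i], the type {ffun B -> C} would be a vector space over R. *)
Notation Free C B := {ffun B -> C^o}.

Definition basis (C : fieldType) (B : finType) (b : B) : Free C B :=
  [ffun a => (a == b)%:R].

Definition tens (C : fieldType) (A B : finType)
  (F : Free C A) (K : Free C B) : Free C (A * B) :=
  [ffun ab => F ab.1 * K ab.2].

(* f (x) k, meant for linear f and k *)
Definition tensmap (C : fieldType) (A A' B B' : finType)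
  (f : Free C A -> Free C A') (k : Free C B -> Free C B')
  (T : Free C (A * B)) : Free C (A' * B') :=
  \sum_(ab : A * B) T ab *: tens (f (basis C ab.1)) (k (basis C ab.2)).

(* The operations of a quasi-bialgebra, without its axioms *)
Record qbialg_data (C : fieldType) (B : finType) := QBialgData {
  qb_mul : Free C B -> Free C B -> Free C B;
  qb_one : Free C B;
  qb_comul : Free C B -> Free C (B * B);
  qb_counit : Free C B -> C;
  qb_coassociator : Free C (B * B * B)
}.

Definition algebra_morphism (C : fieldType) (A B : finType)
  (D : qbialg_data C A) (E : qbialg_data C B)
  (f : {linear Free C A -> Free C B}) : Prop :=
  f (qb_one D) = qb_one E /\
  forall a b, f (qb_mul D a b) = qb_mul E (f a) (f b).

Definition coalgebra_morphism (C : fieldType) (A B : finType)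
  (D : qbialg_data C A) (E : qbialg_data C B)
  (f : {linear Free C A -> Free C B}) : Prop :=
  (forall a, qb_comul E (f a) = tensmap f f (qb_comul D a)) /\
  (forall a, qb_counit E (f a) = qb_counit D a).

Definition quasi_bialgebra_morphism (C : fieldType) (A B : finType)
  (D : qbialg_data C A) (E : qbialg_data C B)
  (f : {linear Free C A -> Free C B}) : Prop :=
  [/\ algebra_morphism D E f,
      coalgebra_morphism D E f &
      tensmap (tensmap f f) f (qb_coassociator D) = qb_coassociator E].

(* Normalized 3-cocycles with values in U(1) *)
Definition is_cocycle3 (C : numClosedFieldType) (gT : finGroupType)
  (w : gT -> gT -> gT -> C) : Prop :=
  [/\ forall a b c, `|w a b c| = 1,
      forall g h, w g 1%g h = 1 &
      forall a b c d,
        w a b c * w a (b * c)%g d * w b c d = w (a * b)%g c d * w a b (c * d)%g].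

Definition pullback_center (C : numClosedFieldType) (gT : finGroupType)
  (w : coset_of 'Z([set: gT])%g -> coset_of 'Z([set: gT])%g ->
       coset_of 'Z([set: gT])%g -> C) : gT -> gT -> gT -> C :=
  fun a b c => w (coset 'Z([set: gT])%g a) (coset 'Z([set: gT])%g b)
                 (coset 'Z([set: gT])%g c).

(* Recall that g ^ x = x^-1 * g * x in a group. *)
Definition theta (C : numClosedFieldType) (gT : finGroupType)
  (w : gT -> gT -> gT -> C) (g x y : gT) : C :=
  w g x y * w x y (g ^ (x * y))%g / w x (g ^ x)%g y.

Definition gamma (C : numClosedFieldType) (gT : finGroupType)
  (w : gT -> gT -> gT -> C) (x g h : gT) : C :=
  w g h x * w x (g ^ x)%g (h ^ x)%g / w g x (h ^ x)%g.

(* The underlying space of the twisted double has basis the pairs (g, x),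
   standing for e_g # x. *)
Definition twisted_double (C : numClosedFieldType) (gT : finGroupType)
  (w : gT -> gT -> gT -> C) : qbialg_data C (gT * gT)%type :=
  {| qb_mul := fun F K =>
       \sum_(a : gT * gT) \sum_(b : gT * gT) (F a * K b) *:
         (if a.1 == (a.2 * b.1 * a.2^-1)%g
          then theta w a.1 a.2 b.2 *: basis C (a.1, (a.2 * b.2)%g) else 0);
     qb_one := \sum_(g : gT) basis C (g, 1%g);
     qb_comul := fun F =>
       \sum_(a : gT * gT) F a *: \sum_(t : gT)
         gamma w a.2 (a.1 * t^-1)%g t *:
           tens (basis C ((a.1 * t^-1)%g, a.2)) (basis C (t, a.2));
     qb_counit := fun F => \sum_(x : gT) F (1%g, x);
     qb_coassociator := \sum_(a : gT) \sum_(b : gT) \sum_(c : gT)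
       (w a b c)^-1 *:
         tens (tens (basis C (a, 1%g)) (basis C (b, 1%g))) (basis C (c, 1%g)) |}.

Definition drinfeld_double (C : numClosedFieldType) (gT : finGroupType) :
  qbialg_data C (gT * gT)%type := twisted_double (fun _ _ _ : gT => 1 : C).

(* S(e_g # x) = e_(x^-1 g^-1 x) # x^-1 *)
Definition double_antipode (C : numClosedFieldType) (gT : finGroupType)
  (F : Free C (gT * gT)) : Free C (gT * gT) :=
  \sum_(a : gT * gT) F a *: basis C ((a.1^-1 ^ a.2)%g, (a.2^-1)%g).

Definition double_hopf_morphism (C : numClosedFieldType) (gT : finGroupType)
  (f : {linear Free C (gT * gT) -> Free C (gT * gT)}) : Prop :=
  [/\ algebra_morphism (drinfeld_double C gT) (drinfeld_double C gT) f,
      coalgebra_morphism (drinfeld_double C gT) (drinfeld_double C gT) f &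
      forall a, f (double_antipode a) = double_antipode (f a)].

Definition double_hopf_automorphism (C : numClosedFieldType)
  (gT : finGroupType)
  (f : {linear Free C (gT * gT) -> Free C (gT * gT)}) : Prop :=
  bijective f /\ double_hopf_morphism f.

Definition rigid_isomorphism (C : numClosedFieldType) (gT : finGroupType)
  (w eta : gT -> gT -> gT -> C)
  (f : {linear Free C (gT * gT) -> Free C (gT * gT)}) : Prop :=
  [/\ bijective f,
      quasi_bialgebra_morphism (twisted_double w) (twisted_double eta) f &
      double_hopf_morphism f].

(* The component u of psi: f |-> (id (x) counit) (psi (f # 1)), where
   f # 1 is tens f (basis C 1). *)
Definition component_u (C : numClosedFieldType) (gT : finGroupType)
  (psi : {linear Free C (gT * gT) -> Free C (gT * gT)})
  (f : Free C gT) : Free C gT :=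
  [ffun g => \sum_(x : gT) psi (tens f (basis C 1%g)) (g, x)].

(* The transpose on the group algebra, for the pairing <e_g, x> = (g == x)
   of functions on the group with the group algebra *)
Definition linear_dual (C : numClosedFieldType) (gT : finGroupType)
  (u : Free C gT -> Free C gT) (a : Free C gT) : Free C gT :=
  [ffun g => \sum_(x : gT) a x * u (basis C g) x].

(* The map on the group whose linear extension is the dual of u.  The default
   value is irrelevant when u is a Hopf algebra morphism, since the dual then
   maps group elements to group elements. *)
Definition group_dual (C : numClosedFieldType) (gT : finGroupType)
  (u : Free C gT -> Free C gT) (x : gT) : gT :=
  odflt 1%g [pick g | linear_dual u (basis C x) == basis C g].

(* Main.v *)
(* For a Hopf automorphism psi = (p, u, r, v) of D(G), the projection of D(G)
   on CG is cocentral and e_k # 1 is central for k in Z(G); hence p(e_k) is 0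
   unless k is central, and p takes its values in the span of Z(G).  So u is an
   algebra morphism, dual to an endomorphism ustar of G.  Conjugation by eps # x
   and the injectivity of psi show that ustar is onto modulo Z(G) and that
   ustar (v x) = x modulo Z(G).  It follows that e_a # y occurs in psi (e_g # x)
   only if ustar a = g and ustar y = x modulo Z(G).  As omega is pulled back from
   G / Z(G), every structure constant of the omega-twisted double at (g, x) thus
   agrees with the one of the (omega o ustar)-twisted double at (a, y), and
   compatibility with the twisted operations is, coefficient by coefficient,
   compatibility with the untwisted ones.  Conversely the coassociators alone
   determine eta from omega o ustar. *)

Require Import Defs.
From mathcomp Require Import all_boot all_order all_algebra all_fingroup all_solvable.
From mathcomp Require Import reals complex.
Import GRing.Theory Num.Theory.
Local Open Scope ring_scope.
Set Implicit Arguments.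
Unset Strict Implicit.

(** * Linear algebra in coordinates: bases, tensor products, idempotents *)

Section FreeModules.
Variable C : fieldType.

Lemma basisE (B : finType) (b a : B) : basis C b a = (a == b)%:R :> C.
Proof. by rewrite ffunE. Qed.

Lemma scale_freeE (B : finType) (k : C) (F : Free C B) b :
  (k *: F) b = k * F b :> C.
Proof. by rewrite ffunE. Qed.

Lemma tensE (A B : finType) (F : Free C A) (K : Free C B) ab :
  tens F K ab = F ab.1 * K ab.2 :> C.
Proof. by rewrite ffunE. Qed.

Definition pointE := (basisE, scale_freeE, tensE).

Lemma sum_basis (B : finType) (F : Free C B) : \sum_b F b *: basis C b = F.
Proof.
apply/ffunP=> a; rewrite sum_ffunE (bigD1 a) //= !pointE eqxx mulr1 big1 ?addr0 //.
by move=> b nba; rewrite !pointE eq_sym (negbTE nba) mulr0.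
Qed.

Lemma linear_lincomb (A B I : finType) (f : {linear Free C A -> Free C B})
    (c : I -> C) (T : I -> Free C A) :
  f (\sum_i c i *: T i) = \sum_i c i *: f (T i).
Proof. by rewrite linear_sum; apply: eq_bigr => i _; rewrite linearZ. Qed.

Lemma tensmapE (A A' B B' : finType) (f : Free C A -> Free C A')
    (k : Free C B -> Free C B') T s t :
  tensmap f k T (s, t) =
  \sum_(ab : A * B) T ab * (f (basis C ab.1) s * k (basis C ab.2) t).
Proof. by rewrite sum_ffunE; apply: eq_bigr => ab _; rewrite !pointE. Qed.

Lemma tensmap_basisE (A A' B B' : finType) (f : Free C A -> Free C A')
    (k : Free C B -> Free C B') a b s t :
  tensmap f k (basis C (a, b)) (s, t) = f (basis C a) s * k (basis C b) t.
Proof.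
rewrite tensmapE (bigD1 (a, b)) //= !pointE eqxx mul1r big1 ?addr0 // => c ncab.
by rewrite pointE (negbTE ncab) mul0r.
Qed.

Lemma tens_basis (A B : finType) (a : A) (b : B) :
  tens (basis C a) (basis C b) = basis C (a, b).
Proof. by apply/ffunP=> -[c d]; rewrite !pointE -natrM mulnb. Qed.

Lemma tensmap_sumE (A A' B B' I : finType) (f : Free C A -> Free C A')
    (k : Free C B -> Free C B') (c : I -> C) (ab : I -> A * B) s t :
  tensmap f k (\sum_i c i *: basis C (ab i)) (s, t) =
  \sum_i c i * (f (basis C (ab i).1) s * k (basis C (ab i).2) t).
Proof.
rewrite tensmapE; under eq_bigr => e _ do rewrite sum_ffunE big_distrl /=.
rewrite exchange_big; apply: eq_bigr => i _; rewrite (bigD1 (ab i)) //=.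
rewrite !pointE eqxx mulr1 [X in _ + X]big1 ?addr0 // => e ne.
by rewrite !pointE (negbTE ne) mulr0 mul0r.
Qed.

Lemma tensmap_sum (A A' B B' I : finType) (f : Free C A -> Free C A')
    (k : Free C B -> Free C B') (c : I -> C) (T : I -> Free C (A * B)) :
  tensmap f k (\sum_i c i *: T i) = \sum_i c i *: tensmap f k (T i).
Proof.
apply/ffunP=> -[s t]; rewrite tensmapE sum_ffunE.
under [RHS]eq_bigr => i _ do rewrite pointE tensmapE big_distrr /=.
rewrite exchange_big; apply: eq_bigr => e _ /=.
rewrite sum_ffunE big_distrl /=; apply: eq_bigr => i _.
by rewrite pointE -mulrA.
Qed.

Lemma basis_inj (B : finType) : injective (@basis C B).
Proof.
move=> b c /ffunP/(_ b); rewrite !basisE eqxx; case: eqP => // _ /eqP.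
by rewrite oner_eq0.
Qed.

(** The sum being 1, some [f t0] is nonzero; cancelling it in the orthogonality relations gives
    [f t0 = 1] and kills every other value. This turns characters of function algebras into
    points. *)
Lemma idempotent_family (T : finType) (f : T -> C) :
    (forall s t, f s * f t = (s == t)%:R * f s) -> \sum_t f t = 1 ->
  exists t0, forall t, f t = (t == t0)%:R.
Proof.
move=> ff f1; have [/existsP[t0 nz]|/existsPn f0] := boolP [exists t, f t != 0].
  exists t0 => t; have [->|nt] := eqVneq t t0.
    by apply: (mulfI nz); rewrite ff eqxx mul1r mulr1.
  by apply: (mulIf nz); rewrite ff (negbTE nt) !mul0r.
have /eqP := oner_neq0 C; rewrite -f1 big1 // => t _.
by apply/eqP; move: (f0 t); rewrite negbK.
Qed.

End FreeModules.

(** * Conjugation and cosets modulo the centre *)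

Section Center.
Variable gT : finGroupType.
Implicit Types a k x y : gT.
Local Notation Z := 'Z([set: gT])%g.
Local Notation q := (coset Z).

Lemma conjg_fixC x y : (x ^ y)%g = x -> (y ^ x)%g = y.
Proof. by move=> xy; apply/conjg_fixP/commgP/commute_sym/commgP/conjg_fixP. Qed.

Lemma centerP_conj k : reflect (forall x, (k ^ x)%g = k) (k \in Z).
Proof.
apply: (iffP (centerP [set: gT] k)) => [[_ kZ] x|kZ].
  by apply/conjg_fixP/commgP/kZ; rewrite in_setT.
by split=> [|x _]; [rewrite in_setT | apply/commgP/conjg_fixP/kZ].
Qed.

Lemma conjg_center a y : y \in Z -> (a ^ y)%g = a.
Proof. by move=> /centerP_conj yZ; apply: conjg_fixC. Qed.

(** [q] is a morphism on the normaliser of the centre, which is the whole group. *)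
Lemma coset_centerM x y : q (x * y)%g = (q x * q y)%g.
Proof.
have nZ t : t \in 'N(Z)%g by rewrite (subsetP (normal_norm (center_normal _))).
by rewrite morphM.
Qed.

Lemma coset_centerV x : q x^-1%g = (q x)^-1%g.
Proof.
have nZ t : t \in 'N(Z)%g by rewrite (subsetP (normal_norm (center_normal _))).
by rewrite morphV.
Qed.

Lemma coset_center_id x : q x = 1%g -> x \in Z.
Proof.
by apply: coset_idr; rewrite (subsetP (normal_norm (center_normal _))).
Qed.

End Center.

(** * Structure constants of the twisted double *)

Section TwistedDouble.
Variables (C : numClosedFieldType) (gT : finGroupType).
Implicit Types (w : gT -> gT -> gT -> C) (F K : Free C (gT * gT)).
Implicit Types (a b c g h t x y z : gT).

Lemma double_mulE w F K a z :
  qb_mul (twisted_double w) F K (a, z) =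
  \sum_y theta w a y (y^-1 * z)%g * (F (a, y) * K ((a ^ y)%g, (y^-1 * z)%g)).
Proof.
rewrite /= sum_ffunE.
(* For given [d] with [d.1 = a], a single [e] contributes to the coefficient at [(a, z)], so the
   double sum collapses to a sum over [y = d.2]. *)
have E (d e : gT * gT) : ((F d * K e) *: (if d.1 == (d.2 * e.1 * d.2^-1)%g
    then theta w d.1 d.2 e.2 *: basis C (d.1, (d.2 * e.2)%g) else 0)) (a, z) =
  (F d * K e * (if (d.1 == a) && (e == (a ^ d.2, d.2^-1 * z))%g
     then theta w d.1 d.2 e.2 else 0) : C).
  case: d e => [d1 d2] [e1 e2] /=; rewrite pointE.
  have -> : (d1 == d2 * e1 * d2^-1)%g = (e1 == d1 ^ d2)%g.
    rewrite -[RHS](inj_eq (conjg_inj d2^-1%g)) conjgK conjgE invgK mulgA.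
    by rewrite eq_sym.
  rewrite !xpair_eqE; have [<-|nd] := eqVneq d1 a; last first.
    case: ifP => _; last by rewrite ffunE.
    by rewrite !pointE xpair_eqE [a == _]eq_sym (negbTE nd) !mulr0.
  case: eqP => _ /=; last by rewrite ffunE.
  have -> : (e2 == d2^-1 * z)%g = (z == d2 * e2)%g.
    by rewrite -[LHS](inj_eq (mulgI d2)) mulKVg eq_sym.
  rewrite !pointE xpair_eqE eqxx /=; case: eqP => _; rewrite /= ?mulr1 ?mulr0 //.
have -> : \sum_d (\sum_e (F d * K e) *: (if d.1 == (d.2 * e.1 * d.2^-1)%g
    then theta w d.1 d.2 e.2 *: basis C (d.1, (d.2 * e.2)%g) else 0)) (a, z) =
  \sum_(d : gT * gT) (if d.1 == a then
    theta w a d.2 (d.2^-1 * z)%g * (F (a, d.2) * K ((a ^ d.2)%g, (d.2^-1 * z)%g))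
    else 0) :> C.
  apply: eq_bigr => d _; rewrite sum_ffunE.
  under eq_bigr => e _ do rewrite E.
  case: eqP => [<-|_] /=; last by apply: big1 => e _; rewrite mulr0.
  rewrite (bigD1 (d.1 ^ d.2, d.2^-1 * z)%g) //= eqxx big1 ?addr0.
    by rewrite mulrC -surjective_pairing.
  by move=> e /negbTE ->; rewrite mulr0.
rewrite -(pair_bigA _ (fun d1 d2 => if d1 == a then
    theta w a d2 (d2^-1 * z)%g * (F (a, d2) * K ((a ^ d2)%g, (d2^-1 * z)%g))
    else 0)) /= (bigD1 a) //= eqxx [X in _ + X]big1 ?addr0 // => d1 /negbTE ->.
by rewrite big1.
Qed.

Lemma double_comulE w F a x b y :
  qb_comul (twisted_double w) F ((a, x), (b, y)) =
  (x == y)%:R * (gamma w x a b * F ((a * b)%g, x)).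
Proof.
(* Only the basis element e_(ab) # x, with [t = b], can produce this tensor. *)
rewrite /= sum_ffunE (bigD1 ((a * b)%g, x)) //= pointE sum_ffunE (bigD1 b) //=.
rewrite !pointE /= mulgK !eqxx xpair_eqE eqxx /= [y == x]eq_sym.
rewrite !big1 ?addr0.
- by rewrite mul1r mulrA [LHS]mulrC [F _ * _]mulrC.
- move=> [d e]; rewrite xpair_eqE negb_and => nde.
  rewrite pointE sum_ffunE big1 ?mulr0 // => t _.
  rewrite !pointE !xpair_eqE /=.
  have [abt|] := eqVneq b t; last by rewrite !mulr0.
  subst t; have [ae|] := eqVneq a (d * b^-1)%g; last by rewrite mul0r mulr0.
  move: nde; rewrite ae mulgKV eqxx /= eq_sym => /negbTE ->.
  by rewrite mul0r mulr0.
- move=> t nt; rewrite !pointE !xpair_eqE [b == t]eq_sym (negbTE nt) andFb.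
  by rewrite !mulr0.
Qed.

Lemma double_oneE w a x : qb_one (twisted_double w) (a, x) = (x == 1%g)%:R.
Proof.
rewrite /= sum_ffunE (bigD1 a) //= pointE xpair_eqE eqxx big1 ?addr0 // => g nga.
by rewrite pointE xpair_eqE eq_sym (negbTE nga).
Qed.

Lemma double_coassociatorE w a b c x y z :
  qb_coassociator (twisted_double w) (((a, x), (b, y)), (c, z)) =
  (w a b c)^-1 * ((x == 1%g)%:R * (y == 1%g)%:R * (z == 1%g)%:R).
Proof.
rewrite /= sum_ffunE (bigD1 a) //= sum_ffunE (bigD1 b) //= sum_ffunE (bigD1 c) //=.
rewrite !pointE !xpair_eqE !eqxx /= !big1 ?addr0 //.
- move=> a' /negbTE na; rewrite sum_ffunE big1 // => b' _.
  rewrite sum_ffunE big1 // => c' _.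
  by rewrite !pointE !xpair_eqE [a == _]eq_sym na !mul0r mulr0.
- move=> b' /negbTE nb; rewrite sum_ffunE big1 // => c' _.
  by rewrite !pointE !xpair_eqE [b == _]eq_sym nb mulr0 mul0r mulr0.
- move=> c' /negbTE nc.
  by rewrite !pointE !xpair_eqE [c == _]eq_sym nc !mulr0.
Qed.

Lemma double_mul_basisE w g x h y :
  qb_mul (twisted_double w) (basis C (g, x)) (basis C (h, y)) =
  ((h == g ^ x)%g%:R * theta w g x y) *: basis C (g, (x * y)%g).
Proof.
apply/ffunP=> -[a z]; rewrite double_mulE (bigD1 x) //= [X in _ + X]big1 ?addr0.
  rewrite !pointE !xpair_eqE eqxx andbT; case: eqP => [->|_]; last first.
    by rewrite mul0r !mulr0.
  rewrite mul1r /= [h == _]eq_sym -[(x^-1 * z == y)%g](inj_eq (mulgI x)) mulKVg.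
  case: eqP => _; last by rewrite !mul0r mulr0.
  by rewrite mul1r /=; case: eqP => [->|_]; rewrite ?mulr0 // mulKg.
by move=> t nt; rewrite !pointE xpair_eqE (negbTE nt) andbF mul0r mulr0.
Qed.

Lemma double_comul_basisE w g x :
  qb_comul (twisted_double w) (basis C (g, x)) =
  \sum_t gamma w x (g * t^-1)%g t *: basis C (((g * t^-1)%g, x), (t, x)).
Proof.
rewrite /= (bigD1 (g, x)) //= basisE eqxx scale1r [X in _ + X]big1 ?addr0.
  by apply: eq_bigr => t _; rewrite tens_basis.
by move=> a na; rewrite basisE (negbTE na) scale0r.
Qed.

Lemma double_coassociator_sumE w :
  qb_coassociator (twisted_double w) =
  \sum_(i : gT * gT * gT) (w i.1.1 i.1.2 i.2)^-1 *:
    basis C (((i.1.1, 1%g), (i.1.2, 1%g)), (i.2, 1%g)).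
Proof.
rewrite /= -(pair_bigA _ (fun ab c => (w ab.1 ab.2 c)^-1 *:
  basis C (((ab.1, 1%g), (ab.2, 1%g)), (c, 1%g)))) /=.
rewrite -(pair_bigA _ (fun a b => \sum_c (w a b c)^-1 *:
  basis C (((a, 1%g), (b, 1%g)), (c, 1%g)))) /=.
by do 3![apply: eq_bigr => ? _]; rewrite !tens_basis.
Qed.

Lemma double_mul_suml w (I : finType) (c : I -> C)
    (F : I -> Free C (gT * gT)) K :
  qb_mul (twisted_double w) (\sum_i c i *: F i) K =
  \sum_i c i *: qb_mul (twisted_double w) (F i) K.
Proof.
apply/ffunP=> -[a z]; rewrite double_mulE sum_ffunE.
under [RHS]eq_bigr => i _ do rewrite pointE double_mulE big_distrr /=.
rewrite exchange_big; apply: eq_bigr => y _ /=.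
rewrite sum_ffunE big_distrl big_distrr /=; apply: eq_bigr => i _.
by rewrite pointE -[X in _ * X]mulrA mulrCA.
Qed.

Lemma double_mul_sumr w (I : finType) (c : I -> C) F
    (K : I -> Free C (gT * gT)) :
  qb_mul (twisted_double w) F (\sum_i c i *: K i) =
  \sum_i c i *: qb_mul (twisted_double w) F (K i).
Proof.
apply/ffunP=> -[a z]; rewrite double_mulE sum_ffunE.
under [RHS]eq_bigr => i _ do rewrite pointE double_mulE big_distrr /=.
rewrite exchange_big; apply: eq_bigr => y _ /=.
rewrite sum_ffunE big_distrr big_distrr /=; apply: eq_bigr => i _.
by rewrite pointE [F _ * _]mulrCA [LHS]mulrCA.
Qed.

Lemma double_comul_sum w (I : finType) (c : I -> C)
    (F : I -> Free C (gT * gT)) :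
  qb_comul (twisted_double w) (\sum_i c i *: F i) =
  \sum_i c i *: qb_comul (twisted_double w) (F i).
Proof.
apply/ffunP=> -[[a x] [b y]]; rewrite double_comulE !sum_ffunE !big_distrr /=.
apply: eq_bigr => i _; rewrite !pointE double_comulE.
by rewrite [gamma _ _ _ _ * _]mulrCA [LHS]mulrCA.
Qed.

Lemma theta1 g x y : theta (fun _ _ _ => 1 : C) g x y = 1.
Proof. by rewrite /theta !mulr1 divr1. Qed.

Lemma gamma1 x g h : gamma (fun _ _ _ => 1 : C) x g h = 1.
Proof. by rewrite /gamma !mulr1 divr1. Qed.

End TwistedDouble.

(** * Matrix entries of a Hopf automorphism of the double *)

Section DoubleAutomorphism.
Variables (C : numClosedFieldType) (gT : finGroupType).
Variable psi : {linear Free C (gT * gT) -> Free C (gT * gT)}.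
Hypothesis psi_aut : double_hopf_automorphism psi.
Implicit Types a b c g h k t x y z : gT.

Definition entry g x a y : C := psi (basis C (g, x)) (a, y).
Local Notation P := entry.
Local Notation D := (drinfeld_double C gT).
Local Notation Z := 'Z([set: gT])%g.
Local Notation q := (coset Z).

Lemma entry_one a y : \sum_g P g 1 a y = (y == 1%g)%:R.
Proof.
case: psi_aut => _ [[psi1 _] _ _].
by rewrite -(double_oneE (fun _ _ _ => 1) a y) -psi1 linear_sum sum_ffunE.
Qed.

Lemma entry_mul g x h x' a z :
  \sum_y P g x a y * P h x' (a ^ y)%g (y^-1 * z)%g =
  (h == g ^ x)%g%:R * P g (x * x')%g a z.
Proof.
case: psi_aut => _ [[_ psiM] _ _].
have /ffunP/(_ (a, z)) := psiM (basis C (g, x)) (basis C (h, x')).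
rewrite double_mul_basisE theta1 mulr1 linearZ pointE double_mulE => ->.
by apply: eq_bigr => y _; rewrite theta1 mul1r.
Qed.

Lemma tensmap_comulE w g x (s t : gT * gT) :
  tensmap psi psi (qb_comul (twisted_double w) (basis C (g, x))) (s, t) =
  \sum_k gamma w x (g * k^-1)%g k *
    (psi (basis C ((g * k^-1)%g, x)) s * psi (basis C (k, x)) t).
Proof. by rewrite double_comul_basisE tensmap_sumE. Qed.

Lemma entry_comul g x a y b y' :
  \sum_k P (g * k^-1)%g x a y * P k x b y' = (y == y')%:R * P g x (a * b)%g y.
Proof.
case: psi_aut => _ [_ [psiD _] _].
have /ffunP/(_ ((a, y), (b, y'))) := psiD (basis C (g, x)).
rewrite tensmap_comulE double_comulE gamma1 mul1r => ->.
by apply: eq_bigr => k _; rewrite gamma1 mul1r.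
Qed.

Lemma entry_counit g x : \sum_y P g x 1%g y = (g == 1%g)%:R.
Proof.
case: psi_aut => _ [_ [_ psi_eps] _].
transitivity (qb_counit D (psi (basis C (g, x)))) => //; rewrite psi_eps /=.
rewrite (bigD1 x) //= big1 ?addr0 => [|y ny].
  by rewrite basisE xpair_eqE eqxx andbT eq_sym.
by rewrite basisE xpair_eqE (negbTE ny) andbF.
Qed.

Lemma psi_eq0 F : psi F = 0 -> F = 0.
Proof.
by case: psi_aut => /bij_inj psi_inj _ F0; apply: psi_inj; rewrite F0 linear0.
Qed.

(** * The component p: central support and central values *)

(* P k 1 1 y is the coefficient of y in p(e_k). *)
Lemma p_mul g h z :
  \sum_y P g 1 1 y * P h 1 1 (y^-1 * z)%g = (g == h)%:R * P g 1 1 z.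
Proof.
have := entry_mul g 1 h 1 1 z; rewrite conjg1 mulg1 eq_sym => <-.
by apply: eq_bigr => y _; rewrite conj1g.
Qed.

(* The projection of the double on the group algebra is cocentral, hence so is
   the component p. *)
Lemma p_cocentral g k y : P (g * k^-1)%g 1 1 y = P (k^-1 * g)%g 1 1 y.
Proof.
(* Under psi the two halves of [F] become instances of [entry_comul] at [(1, b)] and [(b, 1)], which
   agree; injectivity of psi then makes each coefficient of [F] vanish. *)
pose F : Free C (gT * gT) := \sum_k
  (P (g * k^-1)%g 1 1 y - P (k^-1 * g)%g 1 1 y) *: basis C (k, 1%g).
have F0 : F = 0.
  apply: psi_eq0; apply/ffunP=> -[b y']; rewrite [RHS]ffunE linear_sum sum_ffunE.
  under eq_bigr => t _ do rewrite linearZ pointE mulrBl.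
  rewrite sumrB entry_comul mul1g.
  rewrite (reindex_inj (h := fun m => (g * m^-1)%g)) /=; last first.
    by move=> m1 m2 /mulgI/invg_inj.
  under eq_bigr => m _ do rewrite invMg invgK mulgKV mulrC.
  by rewrite entry_comul mulg1; case: eqVneq => [->|_]; rewrite ?mul0r subrr.
have /ffunP/(_ (k, 1%g)) := F0; rewrite sum_ffunE ffunE (bigD1 k) //= pointE.
rewrite basisE eqxx mulr1 [X in _ + X]big1 ?addr0 => [/eqP|t nt].
  by rewrite subr_eq0 => /eqP.
by rewrite !pointE xpair_eqE eq_sym (negbTE nt) mulr0.
Qed.

Lemma p_conjl k x y : P (k ^ x)%g 1 1 y = P k 1 1 y.
Proof. by rewrite conjgE -p_cocentral mulgK. Qed.

(** The p(e_k) are orthogonal idempotents, while p(e_k) = p(e_(k^x)) by cocentrality; so p(e_k) = 0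
    as soon as some conjugate of [k] differs from [k]. *)
Lemma p_suppl k y : P k 1 1 y != 0 -> k \in Z.
Proof.
move=> nz; apply/centerP_conj => x; apply: contraNeq nz => nkx; apply/eqP.
have := p_mul k k y; rewrite eqxx mul1r => <-.
under eq_bigr => t _ do rewrite -[P k 1 1 (_ * _)%g](p_conjl k x).
by rewrite p_mul eq_sym (negbTE nkx) mul0r.
Qed.

Lemma p_conjr k x y : P k 1 1 (y ^ x)%g = P k 1 1 y.
Proof.
have [kZ|nkZ] := boolP (k \in Z); last first.
  have p0 t : P k 1 1 t = 0 by apply: contraNeq nkZ => /p_suppl.
  by rewrite !p0.
case: psi_aut => [[psi' _ psi'K] [[_ psiM] _ _]].
have /centerP_conj kx := kZ.
(* e_k # 1 is central, hence so is its image. *)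
have eC F : qb_mul D (basis C (k, 1%g)) F = qb_mul D F (basis C (k, 1%g)).
  apply/ffunP=> -[b z]; rewrite !double_mulE (bigD1 1%g) //= [in RHS](bigD1 z) //=.
  rewrite !theta1 !pointE !xpair_eqE mulVg invg1 mul1g conjg1 !eqxx !andbT !mul1r.
  have -> : (b ^ z == k)%g = (b == k).
    by rewrite -{1}(kx z) (inj_eq (conjg_inj z)).
  congr (_ + _); first exact: mulrC.
  rewrite big1 ?[in RHS]big1 // => t nt.
    rewrite pointE xpair_eqE -[(t^-1 * z == _)%g](inj_eq (mulgI t)) mulKVg mulg1.
    by rewrite [z == t]eq_sym (negbTE nt) andbF !mulr0.
  by rewrite pointE xpair_eqE (negbTE nt) andbF mul0r mulr0.
(* By surjectivity e_1 # x is an image under psi, so psi(e_k # 1) commutes with it; the coefficient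
   at [(1, y * x)] of the two products is compared. *)
have := psiM (basis C (k, 1%g)) (psi' (basis C (1%g, x))).
rewrite eC psiM psi'K => /ffunP/(_ (1%g, (y * x)%g)).
rewrite !double_mulE (bigD1 x) //= [in RHS](bigD1 y) //= !theta1 !pointE.
rewrite !mul1r !conj1g !xpair_eqE !eqxx mulKg -conjgE eqxx /= !mul1r mulr1.
rewrite !big1 ?addr0 // => t nt.
  rewrite !pointE conj1g xpair_eqE eqxx -(inj_eq (mulgI t)) mulKVg.
  by rewrite (inj_eq (mulIg x)) eq_sym (negbTE nt) !mulr0.
by rewrite pointE xpair_eqE (negbTE nt) andbF mul0r mulr0.
Qed.

(** Dual to [p_suppl]: for distinct [y] the functions sending [k] to [P k 1 1 y] are orthogonal
    idempotents for convolution, and conjugating [y] does not change them. *)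
Lemma p_suppr k y : P k 1 1 y != 0 -> y \in Z.
Proof.
move=> nz; apply/centerP_conj => x; apply: contraNeq nz => nyx; apply/eqP.
have := entry_comul k 1 1 y 1 y; rewrite eqxx mul1r mulg1 => <-.
under eq_bigr => t _ do rewrite -[P t 1 1 y](p_conjr t x).
by rewrite entry_comul eq_sym (negbTE nyx) mul0r.
Qed.

(** * The component u and its dual endomorphism *)

Definition umat g a : C := \sum_y P g 1 a y.

(** In coordinates, psi(e_g # 1) is the sum over k of u(e_(g k^-1)) # p(e_k): [entry_comul] at
    [(a, 1)] with the first group component summed out. *)
Lemma entry_decomp g a y :
  P g 1 a y = \sum_k umat (g * k^-1)%g a * P k 1 1 y.
Proof.
under eq_bigr => k _ do rewrite /umat big_distrl /=.
rewrite exchange_big; under eq_bigr => t _ do rewrite /= entry_comul mulg1.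
rewrite (bigD1 y) //= eqxx mul1r big1 ?addr0 // => t /negbTE ->.
by rewrite mul0r.
Qed.

Lemma entry_suppr g a y : P g 1 a y != 0 -> y \in Z.
Proof.
apply: contraNT => nyZ; rewrite entry_decomp big1 // => k _.
have -> : P k 1 1 y = 0 by apply: contraNeq nyZ => /p_suppr.
by rewrite mulr0.
Qed.

(* Only pairs (y, y') with y central contribute, so u is multiplicative. *)
Lemma umat_mul g h a : umat g a * umat h a = (g == h)%:R * umat g a.
Proof.
transitivity (\sum_z \sum_y P g 1 a y * P h 1 (a ^ y)%g (y^-1 * z)%g).
  rewrite exchange_big /umat big_distrl /=; apply: eq_bigr => y _.
  rewrite [in RHS](reindex_inj (mulgI y)) /= big_distrr /=.
  apply: eq_bigr => z _; rewrite mulKg.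
  have [->|/entry_suppr yZ] := eqVneq (P g 1 a y) 0; first by rewrite !mul0r.
  by rewrite conjg_center.
under eq_bigr => z _ do rewrite entry_mul conjg1 mulg1 eq_sym.
by rewrite -big_distrr.
Qed.

Lemma umat_sum a : \sum_g umat g a = 1.
Proof.
rewrite exchange_big /=; under eq_bigr => y _ do rewrite entry_one.
by rewrite (bigD1 1%g) //= big1 ?addr0 ?eqxx // => y /negbTE ->.
Qed.

Local Notation ustar := (group_dual (component_u psi)).

(** For fixed [a], u followed by evaluation at [a] is a character of the function algebra, hence
    evaluation at one point. So the search in [group_dual] succeeds and its default value never
    arises. *)
Lemma umatE g a : umat g a = (g == ustar a)%:R.
Proof.
have umatE' b h : linear_dual (component_u psi) (basis C b) h = umat h b.
  rewrite ffunE (bigD1 b) //= pointE eqxx mul1r [X in _ + X]big1 ?addr0.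
    by rewrite ffunE; apply: eq_bigr => y _; rewrite tens_basis.
  by move=> t nt; rewrite pointE (negbTE nt) mul0r.
have [t0 ut0] := idempotent_family (fun g h => umat_mul g h a) (umat_sum a).
rewrite ut0 /group_dual; case: pickP => [t /eqP ut|/(_ t0)/eqP[]] /=.
  suff -> : t = t0 by [].
  by apply: (@basis_inj C gT); rewrite -ut; apply/ffunP=> h; rewrite umatE' ut0 pointE.
by apply/ffunP=> h; rewrite umatE' ut0 pointE.
Qed.

Lemma ustarM a b : ustar (a * b) = (ustar a * ustar b)%g.
Proof.
have : umat (ustar (a * b)%g) (a * b)%g = 1 by rewrite umatE eqxx.
have umatM g : umat g (a * b)%g = \sum_k umat (g * k^-1)%g a * umat k b.
  (* Inserting the delta makes the right side of [entry_comul] appear; the sums over [y] and [y']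
     then separate into two entries of [umat]. *)
  transitivity (\sum_y \sum_y' (y == y')%:R * P g 1 (a * b)%g y).
    apply: eq_bigr => y _; rewrite (bigD1 y) //= eqxx mul1r big1 ?addr0 // => t.
    by rewrite eq_sym => /negbTE ->; rewrite mul0r.
  under eq_bigr => y _ do under eq_bigr => y' _ do rewrite -entry_comul.
  under eq_bigr => y _ do rewrite exchange_big /=.
  rewrite exchange_big; apply: eq_bigr => k _ /=.
  rewrite /umat big_distrl; apply: eq_bigr => y _ /=.
  by rewrite big_distrr.
rewrite umatM (bigD1 (ustar b)) //= big1 ?addr0 => [|k nk].
  rewrite !umatE eqxx mulr1; case: eqP => [<-|_ /eqP]; first by rewrite mulgKV.
  by rewrite eq_sym oner_eq0.
by rewrite [umat k b]umatE (negbTE nk) mulr0.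
Qed.

(** * The image of eps # x and conjugation by it *)

Definition vmat x a y : C := \sum_g P g x a y.

Lemma vmat_comul x a y b y' :
  vmat x a y * vmat x b y' = (y == y')%:R * vmat x (a * b)%g y.
Proof.
rewrite [in RHS]/vmat [RHS]big_distrr /=.
under [RHS]eq_bigr => g _ do rewrite -entry_comul.
rewrite exchange_big [X in _ * X]/vmat [LHS]big_distrr /=; apply: eq_bigr => k _.
by rewrite [in LHS]/vmat [LHS]big_distrl [LHS](reindex_inj (mulIg k^-1%g)).
Qed.

(* psi (eps # x) is grouplike, and the second component of a grouplike element
   of the double is a group element. *)
Lemma vmat_supp x : exists v, forall a,
  vmat x a v != 0 /\ forall y, y != v -> vmat x a y = 0.
Proof.
have vmat_idem y y' : vmat x 1 y * vmat x 1 y' = (y == y')%:R * vmat x 1 y.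
  by rewrite vmat_comul mulg1.
have vmat_sum : \sum_y vmat x 1 y = 1.
  rewrite exchange_big; under eq_bigr => g _ do rewrite /= entry_counit.
  by rewrite (bigD1 1%g) //= eqxx big1 ?addr0 // => y /negbTE ->.
have [v v1] := idempotent_family vmat_idem vmat_sum.
exists v => a; split=> [|y ny].
  (* Nonvanishing at every [a]: the values at [a] and at its inverse multiply to the value at 1,
     which is 1. *)
  apply/eqP => va0; have := vmat_comul x a v a^-1 v.
  by rewrite va0 mul0r mulgV v1 eqxx mulr1 => /esym/eqP; rewrite oner_eq0.
have := vmat_comul x a y 1 y.
by rewrite eqxx mul1r mulg1 v1 (negbTE ny) mulr0.
Qed.

(** [entry_mull] and [entry_mulr] are the factorisations e_g # x = (e_g # 1)(eps # x) = (eps #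
    x)(e_(g^x) # 1) in coordinates. *)
Lemma entry_mull g x a z :
  P g x a z = \sum_y P g 1 a y * vmat x (a ^ y)%g (y^-1 * z)%g.
Proof.
under eq_bigr => y _ do rewrite /vmat big_distrr /=.
rewrite exchange_big; under eq_bigr => h _ do rewrite /= entry_mul mul1g conjg1.
by rewrite (bigD1 g) //= eqxx mul1r big1 ?addr0 // => h /negbTE ->; rewrite mul0r.
Qed.

Lemma entry_mulr g x a z :
  P g x a z = \sum_y vmat x a y * P (g ^ x)%g 1 (a ^ y)%g (y^-1 * z)%g.
Proof.
under eq_bigr => y _ do rewrite /vmat big_distrl /=.
rewrite exchange_big; under eq_bigr => h _ do rewrite /= entry_mul mulg1.
rewrite (bigD1 g) //= eqxx mul1r big1 ?addr0 // => h nh.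
by rewrite (inj_eq (conjg_inj x)) eq_sym (negbTE nh) mul0r.
Qed.

(** By the concentration of [vmat x a] at one [v], each of the two factorisations of e_g # x reduces
    to a single term with the same nonzero factor [vmat x a v]. Cancelling it compares psi(e_g # 1)
    with psi(e_(g^x) # 1). *)
Lemma entry_conj x : exists v,
  (forall g a z, P g x a z != 0 -> P g 1 a (z * v^-1)%g != 0) /\
  forall a, ustar (a ^ v) = (ustar a ^ x)%g.
Proof.
have [v vP] := vmat_supp x; exists v.
have Pl g a z : P g x a z = P g 1 a (z * v^-1)%g * vmat x a v.
  rewrite entry_mull (bigD1 (z * v^-1)%g) //= [X in _ + X]big1 ?addr0 => [|y ny].
    have [->|/entry_suppr zZ] := eqVneq (P g 1 a (z * v^-1)%g) 0.
      by rewrite !mul0r.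
    by rewrite conjg_center // invMg invgK mulgKV.
  have [->|/entry_suppr yZ] := eqVneq (P g 1 a y) 0; first by rewrite mul0r.
  rewrite (vP _).2 ?mulr0 //; apply: contraNneq ny => <-.
  by rewrite invMg invgK mulKVg.
have Pr g a z : P g x a z = P (g ^ x)%g 1 (a ^ v)%g (v^-1 * z)%g * vmat x a v.
  rewrite entry_mulr (bigD1 v) //= [X in _ + X]big1 ?addr0 1?mulrC // => y ny.
  by rewrite (vP _).2 ?mul0r.
split=> [g a z|a]; first by apply: contraNneq => Pz; rewrite Pl Pz mul0r.
(* Both sums over the group component are shifted by [v] so that they match term by term under [Pl]
   and [Pr]. *)
have umat_conj : umat (ustar a) a = umat (ustar a ^ x)%g (a ^ v)%g.
  rewrite /umat (reindex_inj (mulIg v^-1%g)) [RHS](reindex_inj (mulgI v^-1%g)) /=.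
  by apply: eq_bigr => z _; apply: (mulIf (vP a).1); rewrite -Pl -Pr.
have := umat_conj; rewrite !umatE eqxx; case: eqP => // _ /eqP.
by rewrite oner_eq0.
Qed.

(** * Supports of the images modulo the centre *)

(** Some term of [entry_decomp] must survive; its [k] is central by [p_suppl], and
    [ustar a = g * k^-1] by [umatE]. *)
Lemma entry1_supp g a y : P g 1 a y != 0 ->
  q (ustar a) = q g /\ y \in Z.
Proof.
move=> nz; split; last exact: entry_suppr nz.
have [k kZ ->] : exists2 k, k \in Z & ustar a = (g * k^-1)%g.
  apply/exists_eq_inP; apply: contraNT nz => /exists_inPn nk.
  rewrite entry_decomp big1 // => k _; rewrite umatE eq_sym.
  have [kZ|] := boolP (k \in Z); first by rewrite (negbTE (nk _ kZ)) mul0r.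
  by move=> nkZ; rewrite [P k _ _ _](contraNeq (@p_suppl k y)) ?mulr0.
by rewrite coset_centerM coset_centerV (coset_id kZ) invg1 mulg1.
Qed.

(* Otherwise psi would vanish on e_g # 1. *)
Lemma ustar_cover g : exists a, q (ustar a) = q g.
Proof.
suff /existsP[[a y] /entry1_supp[]] : [exists ay, P g 1 ay.1 ay.2 != 0].
  by exists a.
apply/existsP; apply/existsP; apply: contraT => /existsPn P0.
have /ffunP/(_ (g, 1%g)) : basis C (g, 1%g) = 0 :> Free C (gT * gT).
  by apply/psi_eq0/ffunP => -[a y]; move: (P0 (a, y)); rewrite negbK ffunE => /eqP.
by rewrite basisE eqxx ffunE => /eqP; rewrite oner_eq0.
Qed.

(** By [ustar_cover] every group element is some [ustar a] times a central element, so commuting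
    with the image of [ustar] suffices. *)
Lemma centralises_ustar c : (forall a, (ustar a ^ c)%g = ustar a) -> c \in Z.
Proof.
move=> ca; apply/centerP_conj => g; apply: conjg_fixC.
have [a qag] := ustar_cover g.
have /coset_center_id/centerP_conj zZ : q ((ustar a)^-1 * g)%g = 1%g.
  by rewrite coset_centerM coset_centerV qag mulVg.
by rewrite -[g](mulKVg (ustar a)) conjMg ca zZ.
Qed.

Lemma ustar1 : ustar 1%g = 1%g.
Proof. by apply: (mulgI (ustar 1%g)); rewrite -ustarM !mulg1. Qed.

Lemma ustarV a : ustar a^-1%g = (ustar a)^-1%g.
Proof. by apply: (mulgI (ustar a)); rewrite -ustarM !mulgV ustar1. Qed.

Lemma ustarJ a b : ustar (a ^ b)%g = (ustar a ^ ustar b)%g.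
Proof. by rewrite !conjgE !ustarM ustarV. Qed.

Lemma entry_supp g x a y : P g x a y != 0 ->
  q (ustar a) = q g /\ q (ustar y) = q x.
Proof.
have [v [Pv ustar_conj]] := entry_conj x.
move=> /Pv/entry1_supp[-> yvZ]; split=> //.
(* Here [y * v^-1] is central, so its image under [ustar] centralises the image of [ustar] and is
   trivial modulo the centre. *)
rewrite -[y](mulgKV v) ustarM coset_centerM coset_id ?mul1g; last first.
  by apply: centralises_ustar => b; rewrite -ustarJ conjg_center.
(* It remains that [ustar v] is [x] modulo the centre: both act alike by conjugation on the image of
   [ustar]. *)
apply/eqP; rewrite eq_mulgV1 -coset_centerV -coset_centerM; apply/eqP/coset_id.
by apply: centralises_ustar => b; rewrite conjgM -ustarJ ustar_conj conjgK.
Qed.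

(** * Transport of the twisted structure *)

Section Twist.
Variables (w : coset_of Z -> coset_of Z -> coset_of Z -> C).
Variable eta : gT -> gT -> gT -> C.
Local Notation om := (pullback_center w).

(** [om] depends only on cosets, so by [entry_supp] all nonzero terms carry the same scalar; once it
    is factored out, psi(1) = 1 evaluates the rest. *)
Lemma coassociator_image a x b y c z :
  tensmap (tensmap psi psi) psi (qb_coassociator (twisted_double om))
    (((a, x), (b, y)), (c, z)) =
  (om (ustar a) (ustar b) (ustar c))^-1 *
    ((x == 1%g)%:R * (y == 1%g)%:R * (z == 1%g)%:R).
Proof.
rewrite double_coassociator_sumE tensmap_sumE.
transitivity (\sum_(i : gT * gT * gT) (om (ustar a) (ustar b) (ustar c))^-1 *
   (P i.1.1 1 a x * P i.1.2 1 b y * P i.2 1 c z)).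
  apply: eq_bigr => -[[a' b'] c'] _ /=; rewrite tensmap_basisE -!/(entry _ _ _ _).
  have [->|/entry_supp[qa _]] := eqVneq (P a' 1 a x) 0.
    by rewrite !mul0r !mulr0.
  have [->|/entry_supp[qb _]] := eqVneq (P b' 1 b y) 0.
    by rewrite mulr0 !mul0r !mulr0.
  have [->|/entry_supp[qc _]] := eqVneq (P c' 1 c z) 0; first by rewrite !mulr0.
  by rewrite /pullback_center qa qb qc.
rewrite -big_distrr /=; congr (_ * _).
rewrite -(pair_bigA _ (fun i c' => P i.1 1 a x * P i.2 1 b y * P c' 1 c z)) /=.
under eq_bigr => i _ do rewrite -big_distrr /= entry_one.
rewrite -big_distrl /=; congr (_ * _).
rewrite -(pair_bigA _ (fun a' b' => P a' 1 a x * P b' 1 b y)) /=.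
under eq_bigr => i _ do rewrite -big_distrr /= entry_one.
by rewrite -big_distrl /= entry_one.
Qed.

Lemma coassociator_twist :
  tensmap (tensmap psi psi) psi (qb_coassociator (twisted_double om)) =
    qb_coassociator (twisted_double eta) <->
  forall a b c, om (ustar a) (ustar b) (ustar c) = eta a b c.
Proof.
split=> [/ffunP eq_co a b c|om_eta].
  have := eq_co (((a, 1%g), (b, 1%g)), (c, 1%g)).
  by rewrite coassociator_image double_coassociatorE !eqxx !mulr1 => /invr_inj.
apply/ffunP=> -[[[a x] [b y]] [c z]].
by rewrite coassociator_image double_coassociatorE om_eta.
Qed.

Hypothesis om_eta : forall a b c, om (ustar a) (ustar b) (ustar c) = eta a b c.

(** [theta] is built from [om] by group operations, which [ustar] and [q] respect, so only the
    cosets of the arguments matter. *)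
Lemma theta_twist g x y a x' y' :
    q (ustar a) = q g -> q (ustar x') = q x -> q (ustar y') = q y ->
  theta eta a x' y' = theta om g x y.
Proof.
move=> qa qx qy; rewrite /theta -!om_eta !ustarJ ustarM /pullback_center.
by rewrite !conjgE !(coset_centerM, coset_centerV) qa qx qy.
Qed.

Lemma gamma_twist g h x a b x' :
    q (ustar a) = q g -> q (ustar b) = q h -> q (ustar x') = q x ->
  gamma eta x' a b = gamma om x g h.
Proof.
move=> qa qb qx; rewrite /gamma -!om_eta !ustarJ /pullback_center.
by rewrite !conjgE !(coset_centerM, coset_centerV) qa qb qx.
Qed.

Lemma twist_mul_basis g x h y :
  psi (qb_mul (twisted_double om) (basis C (g, x)) (basis C (h, y))) =
  qb_mul (twisted_double eta) (psi (basis C (g, x))) (psi (basis C (h, y))).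
Proof.
apply/ffunP=> -[a z]; rewrite double_mul_basisE linearZ pointE double_mulE.
rewrite mulrAC -[psi _ _]/(P _ _ _ _) -entry_mul big_distrl /=.
apply: eq_bigr => t _; rewrite mulrC -!/(entry _ _ _ _).
(* A term either vanishes on both sides or lies in the support, where the two [theta] factors
   agree. *)
have [->|/entry_supp[qa qt]] := eqVneq (P g x a t) 0; first by rewrite !mul0r !mulr0.
have [->|/entry_supp[_ qz]] := eqVneq (P h y (a ^ t)%g (t^-1 * z)%g) 0.
  by rewrite !mulr0.
by rewrite (theta_twist qa qt qz).
Qed.

Lemma twist_comul_basis g x :
  qb_comul (twisted_double eta) (psi (basis C (g, x))) =
  tensmap psi psi (qb_comul (twisted_double om) (basis C (g, x))).
Proof.
apply/ffunP=> -[[a y] [b y']]; rewrite double_comulE tensmap_comulE.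
rewrite mulrCA -[psi _ _]/(P _ _ _ _) -entry_comul big_distrr /=.
apply: eq_bigr => k _; rewrite -!/(entry _ _ _ _).
have [->|/entry_supp[qa qy]] := eqVneq (P (g * k^-1)%g x a y) 0.
  by rewrite mul0r !mulr0.
have [->|/entry_supp[qb _]] := eqVneq (P k x b y') 0; first by rewrite !mulr0.
by rewrite (gamma_twist qa qb qy).
Qed.

Lemma twist_mul F K :
  psi (qb_mul (twisted_double om) F K) =
  qb_mul (twisted_double eta) (psi F) (psi K).
Proof.
rewrite -(sum_basis F) -(sum_basis K) !double_mul_suml !linear_lincomb.
rewrite double_mul_suml; apply: eq_bigr => -[g x] _; congr (_ *: _).
rewrite !double_mul_sumr linear_lincomb; apply: eq_bigr => -[h y] _.
by congr (_ *: _); exact: twist_mul_basis.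
Qed.

Lemma twist_comul F :
  qb_comul (twisted_double eta) (psi F) =
  tensmap psi psi (qb_comul (twisted_double om) F).
Proof.
rewrite -(sum_basis F) linear_lincomb.
rewrite !double_comul_sum tensmap_sum; apply: eq_bigr => -[g x] _.
by congr (_ *: _); exact: twist_comul_basis.
Qed.

End Twist.

Lemma rigid_isomorphismP (w : coset_of Z -> coset_of Z -> coset_of Z -> C)
    (eta : gT -> gT -> gT -> C) :
  rigid_isomorphism (pullback_center w) eta psi <->
  forall a b c, pullback_center w (ustar a) (ustar b) (ustar c) = eta a b c.
Proof.
split=> [[_ [_ _ /coassociator_twist]] //|om_eta].
case: (psi_aut) => psi_bij psi_hopf; case: (psi_hopf) => [[psi1 _] [_ psi_eps] _].
split=> //; split; last exact/coassociator_twist.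
(* Unit and counit do not depend on the twist, so those conditions carry over from the untwisted
   double. *)
- by split; [exact: psi1 | exact: twist_mul].
- by split; [exact: twist_comul | exact: psi_eps].
Qed.

End DoubleAutomorphism.

Theorem theorem12p8 (R : realType) (gT : finGroupType)
  (w : coset_of 'Z([set: gT])%g -> coset_of 'Z([set: gT])%g ->
       coset_of 'Z([set: gT])%g -> R[i])
  (eta : gT -> gT -> gT -> R[i])
  (psi : {linear {ffun gT * gT -> R[i]^o} -> {ffun gT * gT -> R[i]^o}})
  (hw : is_cocycle3 w) (heta : is_cocycle3 eta)
  (hpsi : double_hopf_automorphism psi) :
  rigid_isomorphism (pullback_center w) eta psi <->
  (forall x y z : gT,
     pullback_center w (group_dual (component_u psi) x)
                       (group_dual (component_u psi) y)
                       (group_dual (component_u psi) z) = eta x y z).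
Proof. exact: rigid_isomorphismP. Qed.
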